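(* Let $f:\mathbb{R}^{m\times n}\to\mathbb{R}$ be twice differentiable, let $g(A,B)=f(AB^\top)$ for $(A,B)\in\mathbb{R}^{m\times r}\times\mathbb{R}^{n\times r}$, and let $(A,B)\in\mathbb{R}^{m\times r}\times\mathbb{R}^{n\times r}$. (a) If $(A,B)$ is a second-order stationary point (SOSP) of $g$, then $X=AB^\top$ is a fixed point of projected gradient descent (PGD) on $\min_{\mathrm{rank}(X)\le r} f(X)$ with any step size $\eta>0$ satisfying $\eta\le 1/\beta_{\mathrm{local}}(X)$. (b) Conversely, if $(A,B)$ is not a SOSP of $g$, then $X=AB^\top$ is not a local minimum of $\min_{\mathrm{rank}(X)\le r} f(X)$.
   Context: Let $m,n,r$ be positive integers with $r\le\min\{m,n\}$. $\|\cdot\|_F$ is the Frobenius norm and $\langle\cdot,\cdot\rangle$ the trace inner product. SOSP: $(A,B)$ is a second-order stationary point of $g$ if $\nabla g(A,B)=0$ and $\nabla^2 g(A,B)\succeq 0$ (as a quadratic form on $\mathbb{R}^{m\times r}\times\mathbb{R}^{n\times r}$). PGD with step size $\eta>0$ iterates $X\leftarrow \mathcal{P}_r(X-\eta\nabla f(X))$, where $\mathcal{P}_r(Z)$ is a (possibly non-unique) element of $\arg\min_{\mathrm{rank}(X')\le r}\|X'-Z\|_F$. A matrix $X$ is a fixed point of PGD at step size $\eta$ if $X\in\arg\min_{\mathrm{rank}(X')\le r}\|X'-(X-\eta\nabla f(X))\|_F$. Local curvature: for $X$ with $\mathrm{rank}(X)\le r$, $$\beta_{\mathrm{local}}(X)=\lim_{\epsilon\to0}\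 \sup_{\substack{0<\|Y-X\|_F\le\epsilon\\ \mathrm{rank}(Y)\le r}}\frac{f(Y)-f(X)-\langle\nabla f(X),Y-X\rangle}{\frac12\|X-Y\|_F^2}.$$ If $\beta_{\mathrm{local}}(X)=0$, $1/\beta_{\mathrm{local}}(X)$ is read as $+\infty$. A local minimum of $\min_{\mathrm{rank}(X)\le r}f(X)$ is a matrix $X$ with $\mathrm{rank}(X)\le r$ and $f(X)\le f(Y)$ for all $Y$ with $\mathrm{rank}(Y)\le r$ in some neighborhood of $X$. *)

(* Defs.v *)
From HB Require Import structures.
From mathcomp Require Import all_boot all_order all_algebra.
From mathcomp Require Import all_classical all_reals all_analysis.

Set Implicit Arguments.
Unset Strict Implicit.
Unset Printing Implicit Defensive.
Import Order.TTheory GRing.Theory Num.Theory.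
Import numFieldNormedType.Exports.

Local Open Scope classical_set_scope.
Local Open Scope ring_scope.

(* The library norm on matrices is the max norm; it induces the same topology
   and the same notion of differentiability as the Frobenius norm, and is used
   below only through those two. *)

Definition trace_inner (R : realType) (p q : nat) (M N : 'M[R]_(p, q)) : R :=
  \tr (M^T *m N).

Definition frob_norm (R : realType) (p q : nat) (M : 'M[R]_(p, q)) : R :=
  Num.sqrt (trace_inner M M).

Definition grad (R : realType) (p q : nat) (f : 'M[R]_(p, q) -> R)
    (X : 'M[R]_(p, q)) : 'M[R]_(p, q) :=
  \matrix_(i, j) derive f X (delta_mx i j).

(* The derivative of f is identified with its gradient, so that the second
   derivative of f is the differential of [grad f]. *)
Definition twice_differentiable (R : realType) (p q : nat)
    (f : 'M[R]_(p, q) -> R) : Prop :=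
  forall X, differentiable f X /\ differentiable (grad f) X.

Definition factored (R : realType) (m n r : nat) (f : 'M[R]_(m, n) -> R)
    (P : 'M[R]_(m, r) * 'M[R]_(n, r)) : R :=
  f (P.1 *m P.2^T).

Definition grad2 (R : realType) (m n r : nat)
    (g : 'M[R]_(m, r) * 'M[R]_(n, r) -> R)
    (P : 'M[R]_(m, r) * 'M[R]_(n, r)) : 'M[R]_(m, r) * 'M[R]_(n, r) :=
  (grad (fun A => g (A, P.2)) P.1, grad (fun B => g (P.1, B)) P.2).

(* The Hessian quadratic form W |-> <D(grad g)(P)[W], W>. *)
Definition hess2 (R : realType) (m n r : nat)
    (g : 'M[R]_(m, r) * 'M[R]_(n, r) -> R)
    (P W : 'M[R]_(m, r) * 'M[R]_(n, r)) : R :=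
  let H := 'd (grad2 g) P W in
  trace_inner H.1 W.1 + trace_inner H.2 W.2.

Definition SOSP (R : realType) (m n r : nat)
    (g : 'M[R]_(m, r) * 'M[R]_(n, r) -> R)
    (P : 'M[R]_(m, r) * 'M[R]_(n, r)) : Prop :=
  grad2 g P = 0 /\ forall W, 0 <= hess2 g P W.

Definition best_rank_approx (R : realType) (m n r : nat) (Z : 'M[R]_(m, n)) :
    set 'M[R]_(m, n) :=
  [set X | (\rank X <= r)%N /\
    forall X' : 'M[R]_(m, n), (\rank X' <= r)%N ->
      frob_norm (X - Z) <= frob_norm (X' - Z)].

Definition pgd_fixed_point (R : realType) (m n r : nat)
    (f : 'M[R]_(m, n) -> R) (eta : R) (X : 'M[R]_(m, n)) : Prop :=
  best_rank_approx r (X - eta *: grad f X) X.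

Definition curvature_quotient (R : realType) (m n : nat)
    (f : 'M[R]_(m, n) -> R) (X Y : 'M[R]_(m, n)) : R :=
  (f Y - f X - trace_inner (grad f X) (Y - X)) /
  (2^-1 * frob_norm (X - Y) ^+ 2).

Definition beta_local (R : realType) (m n r : nat)
    (f : 'M[R]_(m, n) -> R) (X : 'M[R]_(m, n)) : \bar R :=
  lim (ereal_sup [set (curvature_quotient f X Y)%:E | Y in
         [set Y : 'M[R]_(m, n) |
            0 < frob_norm (Y - X) <= eps /\ (\rank Y <= r)%N]]
       @[eps --> (0 : R)^'+]).

Definition local_min_rank (R : realType) (m n r : nat)
    (f : 'M[R]_(m, n) -> R) (X : 'M[R]_(m, n)) : Prop :=
  (\rank X <= r)%N /\ \forall Y \near X, (\rank Y <= r)%N -> f X <= f Y.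

(* Main.v *)
(* Write X = A B^T and G = grad f(X). The curve t |-> (A + t U)(B + t V)^T =
   X + t D + t^2 U V^T, with D = U B^T + A V^T, stays in the set of matrices of
   rank at most r, and the first and second derivatives of f along it are those of
   the factored function in direction (U, V), namely <G, D> and
   <D(grad f)(X) D, D> + 2 <G, U V^T>. A local minimum therefore is a SOSP, which
   is (b).
   For (a), G B = 0 and G^T A = 0. If A has a nontrivial kernel, the Hessian forces
   G = 0. Otherwise, comparing the second-order expansion along the curve with the
   definition of the local curvature gives |D|^2 + 2 eta <G, U V^T> >= 0 for all
   U, V; rank-one choices of U and V turn this into
   eta sigma_1(G) <= sigma_r(X), and then X is a best rank-r approximation of
   X - eta G because the row and column spaces of X and G are orthogonal. *)

Require Import Defs.
From HB Require Import structures.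
From mathcomp Require Import all_boot all_order all_algebra.
From mathcomp Require Import all_classical all_reals all_analysis.
From mathcomp Require Import ring lra.
Import Order.TTheory GRing.Theory Num.Theory.
Import numFieldNormedType.Exports.
Local Open Scope classical_set_scope.
Local Open Scope ring_scope.

(** * Algebra of the trace inner product *)

Lemma trace_innerE {R : realType} {p q} (M N : 'M[R]_(p, q)) :
  trace_inner M N = \sum_i \sum_j M i j * N i j.
Proof.
rewrite /trace_inner /mxtrace exchange_big /=; apply: eq_bigr => j _.
by rewrite mxE; apply: eq_bigr => i _; rewrite mxE.
Qed.

Lemma trace_innerC {R : realType} {p q} (M N : 'M[R]_(p, q)) :
  trace_inner M N = trace_inner N M.
Proof. by rewrite /trace_inner -mxtrace_tr trmx_mul trmxK. Qed.

Lemma trace_innerDr {R : realType} {p q} (M N K : 'M[R]_(p, q)) :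
  trace_inner M (N + K) = trace_inner M N + trace_inner M K.
Proof. by rewrite /trace_inner mulmxDr mxtraceD. Qed.

Lemma trace_innerZr {R : realType} {p q} a (M N : 'M[R]_(p, q)) :
  trace_inner M (a *: N) = a * trace_inner M N.
Proof. by rewrite /trace_inner -scalemxAr mxtraceZ. Qed.

Lemma trace_innerDl {R : realType} {p q} (M N K : 'M[R]_(p, q)) :
  trace_inner (M + N) K = trace_inner M K + trace_inner N K.
Proof. by rewrite trace_innerC trace_innerDr !(trace_innerC K). Qed.

Lemma trace_innerZl {R : realType} {p q} a (M N : 'M[R]_(p, q)) :
  trace_inner (a *: M) N = a * trace_inner M N.
Proof. by rewrite trace_innerC trace_innerZr trace_innerC. Qed.

Lemma trace_innerNr {R : realType} {p q} (M N : 'M[R]_(p, q)) :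
  trace_inner M (- N) = - trace_inner M N.
Proof. by rewrite -scaleN1r trace_innerZr mulN1r. Qed.

Lemma trace_innerNl {R : realType} {p q} (M N : 'M[R]_(p, q)) :
  trace_inner (- M) N = - trace_inner M N.
Proof. by rewrite -scaleN1r trace_innerZl mulN1r. Qed.

Lemma trace_inner0r {R : realType} {p q} (M : 'M[R]_(p, q)) :
  trace_inner M 0 = 0.
Proof. by rewrite /trace_inner mulmx0 mxtrace0. Qed.

Lemma trace_inner0l {R : realType} {p q} (M : 'M[R]_(p, q)) :
  trace_inner 0 M = 0.
Proof. by rewrite trace_innerC trace_inner0r. Qed.

Lemma trace_inner_mull {R : realType} {p q k} (M : 'M[R]_(p, q))
    (N : 'M[R]_(q, k)) (K : 'M[R]_(p, k)) :
  trace_inner (M *m N) K = trace_inner N (M^T *m K).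
Proof. by rewrite /trace_inner trmx_mul mulmxA. Qed.

Lemma trace_inner_mulr {R : realType} {p q k} (M : 'M[R]_(p, q))
    (N : 'M[R]_(q, k)) (K : 'M[R]_(p, k)) :
  trace_inner (M *m N) K = trace_inner M (K *m N^T).
Proof. by rewrite /trace_inner trmx_mul -mulmxA mxtrace_mulC mulmxA. Qed.

Lemma trace_inner_tr {R : realType} {p q} (M N : 'M[R]_(p, q)) :
  trace_inner M^T N^T = trace_inner M N.
Proof. by rewrite [RHS]trace_innerC /trace_inner trmxK mxtrace_mulC. Qed.

Lemma trace_inner_ge0 {R : realType} {p q} (M : 'M[R]_(p, q)) :
  0 <= trace_inner M M.
Proof.
by rewrite trace_innerE; do 2!apply: sumr_ge0 => ? _; rewrite -expr2 sqr_ge0.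
Qed.

Lemma trace_inner_eq0 {R : realType} {p q} (M : 'M[R]_(p, q)) :
  (trace_inner M M == 0) = (M == 0).
Proof.
apply/idP/eqP => [|->]; last by rewrite trace_inner0r.
rewrite trace_innerE psumr_eq0 => [/allP M0|i _]; last first.
  by apply: sumr_ge0 => ? _; rewrite -expr2 sqr_ge0.
apply/matrixP => i j; rewrite mxE; apply/eqP; rewrite -sqrf_eq0 expr2.
move: (M0 i (mem_index_enum _)); rewrite psumr_eq0 => [/allP/(_ j)|? _].
  by apply; rewrite mem_index_enum.
by rewrite -expr2 sqr_ge0.
Qed.

Lemma trace_inner_col {R : realType} {p q} (M N : 'M[R]_(p, q)) :
  trace_inner M N = \sum_j trace_inner (col j M) (col j N).
Proof.
rewrite trace_innerE exchange_big /=; apply: eq_bigr => j _.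
rewrite trace_innerE; apply: eq_bigr => i _.
by rewrite big_ord1 !mxE.
Qed.

Lemma trace_inner_col_row {R : realType} {p q} (x z : 'cV[R]_p) (y w : 'cV[R]_q) :
  trace_inner (x *m y^T) (z *m w^T) = trace_inner x z * trace_inner y w.
Proof.
rewrite !trace_innerE mulr_suml; apply: eq_bigr => i _.
rewrite big_ord1 mulr_sumr; apply: eq_bigr => j _.
by rewrite !mxE !big_ord1 !mxE; ring.
Qed.

(** * Orthogonal projectors and best approximation of bounded rank *)

(** The orthogonal projector onto the column space of [C] when [C] has full column rank, the case in
    which the Gram matrix is invertible. *)
Definition colproj {R : realType} {p k} (C : 'M[R]_(p, k)) : 'M[R]_p :=
  C *m invmx (C^T *m C) *m C^T.

(** If [v *m C^T *m C = 0], then [v *m C^T] has squared norm zero, and full rank of [C] gives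
    [v = 0]. *)
Lemma gram_unit {R : realType} {p k} (C : 'M[R]_(p, k)) :
  \rank C = k -> C^T *m C \in unitmx.
Proof.
move=> rC; rewrite -row_free_unit; apply/inj_row_free => v vC0.
have Cfree : row_free C^T by rewrite /row_free mxrank_tr rC.
apply: (row_free_inj Cfree); rewrite mul0mx.
apply/eqP; rewrite -trace_inner_eq0 /trace_inner.
by rewrite mxtrace_mulC trmx_mul trmxK mulmxA -(mulmxA v) vC0 mul0mx mxtrace0.
Qed.

Lemma colproj_tr {R : realType} {p k} (C : 'M[R]_(p, k)) :
  (colproj C)^T = colproj C.
Proof. by rewrite /colproj !trmx_mul trmxK trmx_inv trmx_mul trmxK mulmxA. Qed.

Lemma colprojK {R : realType} {p k} (C : 'M[R]_(p, k)) :
  \rank C = k -> colproj C *m C = C.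
Proof.
by move=> rC; rewrite /colproj -!mulmxA mulVmx ?gram_unit // mulmx1.
Qed.

Lemma colproj_idem {R : realType} {p k} (C : 'M[R]_(p, k)) :
  \rank C = k -> colproj C *m colproj C = colproj C.
Proof. by move=> rC; rewrite {2}/colproj !mulmxA colprojK. Qed.

Lemma mxtrace_colproj {R : realType} {p k} (C : 'M[R]_(p, k)) :
  \rank C = k -> \tr (colproj C) = k%:R.
Proof.
by move=> rC; rewrite mxtrace_mulC mulmxA mulmxV ?gram_unit // mxtrace1.
Qed.

Lemma trace_inner_proj {R : realType} {p} (P Q : 'M[R]_p) :
  P^T = P -> P *m P = P -> Q^T = Q -> Q *m Q = Q ->
  trace_inner (P *m Q) (P *m Q) = \tr (P *m Q).
Proof.
move=> Pt PP Qt QQ; rewrite /trace_inner trmx_mul Pt Qt.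
by rewrite mulmxA -(mulmxA Q P P) PP mxtrace_mulC mulmxA QQ mxtrace_mulC.
Qed.

(** A comparison of the quadratic forms of [M^T *m M] and [N^T *m N] passes to matrices by summing
    over the columns of [K]. *)
Lemma trace_inner_mull_le {R : realType} {p q k l} (M : 'M[R]_(p, q))
    (N : 'M[R]_(k, q)) (K : 'M[R]_(q, l)) (s t : R) :
  (forall u : 'cV_q, s * trace_inner (M *m u) (M *m u) <=
     t * trace_inner (N *m u) (N *m u)) ->
  s * trace_inner (M *m K) (M *m K) <= t * trace_inner (N *m K) (N *m K).
Proof.
move=> H; rewrite (trace_inner_col (M *m K)) (trace_inner_col (N *m K)).
rewrite !mulr_sumr; apply: ler_sum => j _.
by rewrite !colE -!mulmxA; exact: H.
Qed.

Lemma trace_inner_idem {R : realType} {p q} (P : 'M[R]_p) (M : 'M[R]_(p, q)) :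
  P^T = P -> P *m P = P -> trace_inner (P *m M) (P *m M) = trace_inner M (P *m M).
Proof. by move=> Pt PP; rewrite trace_inner_mull Pt mulmxA PP. Qed.

(* Projecting onto the complement of the column space of [X'] kills [X'], so
   only the captured part of [(X - G) (X - G)^T = X X^T + G G^T] matters; [s]
   separates the spectra of the two orthogonal summands. *)
Lemma spectral_gap_best_approx {R : realType} {m n r}
    (A : 'M[R]_(m, r)) (B : 'M[R]_(n, r)) (G : 'M[R]_(m, n)) (s : R) :
    \rank A = r -> G *m B = 0 -> G^T *m A = 0 -> 0 <= s ->
    (forall u : 'cV_m, trace_inner (G^T *m u) (G^T *m u) <= s * trace_inner u u) ->
    (forall c : 'cV_r, s * trace_inner (A *m c) (A *m c) <=
       trace_inner ((A *m B^T)^T *m (A *m c)) ((A *m B^T)^T *m (A *m c))) ->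
  best_rank_approx r (A *m B^T - G) (A *m B^T).
Proof.
set X := A *m B^T => rA GB GA s0 hG hX; split.
  by apply: leq_trans (mxrankM_maxl _ _) _; rewrite rA.
move=> X' rX'; apply: ler_wsqrtr.
have rC : \rank (col_base X') = \rank X' by apply/eqP; exact: (col_base_full X').
set Q := colproj (col_base X'); set P := colproj A.
have [Pt PP] : P^T = P /\ P *m P = P by rewrite colproj_tr colproj_idem.
have [Qt QQ] : Q^T = Q /\ Q *m Q = Q by rewrite colproj_tr colproj_idem.
have compl (S : 'M[R]_m) : S^T = S -> S *m S = S ->
    (1%:M - S)^T = 1%:M - S /\ (1%:M - S) *m (1%:M - S) = 1%:M - S.
  move=> St SS; rewrite raddfB /= St trmx1.
  by rewrite mulmxBl mul1mx mulmxBr mulmx1 SS subrr subr0.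
have [Nt NN] := compl _ Qt QQ; have [Nt' NN'] := compl _ Pt PP.
set N := 1%:M - Q in Nt NN *.
have NX' : N *m X' = 0.
  by rewrite -(mulmx_base X') mulmxA mulmxBl mul1mx colprojK // subrr mul0mx.
have pyth q (M : 'M[R]_(m, q)) :
    trace_inner M M = trace_inner (Q *m M) (Q *m M) + trace_inner (N *m M) (N *m M).
  rewrite !trace_inner_idem // -trace_innerDr -mulmxDl.
  by rewrite /N addrC subrK mul1mx.
have -> : X - (X - G) = G by rewrite opprB addrC subrK.
rewrite (pyth _ (X' - _)) (mulmxBr N X') NX' sub0r (mulmxBr N X) trace_innerNl trace_innerNr.
rewrite opprK trace_innerDl !trace_innerDr !trace_innerNl !trace_innerNr opprK.
(* [G *m B = 0] makes the row spaces of [X] and [G] orthogonal, and left multiplication by [N]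
   preserves this. *)
have XG0 : trace_inner (N *m X) (N *m G) = 0.
  by rewrite /X mulmxA trace_inner_mulr trmxK -mulmxA GB mulmx0 trace_inner0r.
rewrite XG0 (trace_innerC (N *m G)) XG0 (pyth _ G).
(* [G^T] kills the range of [P], so only [(1 - P) Q] counts. Its squared norm is
   [\tr Q - \tr (P *m Q)], and [\tr Q] is the rank of [X'], at most [r]. *)
have HG : trace_inner (Q *m G) (Q *m G) <= s * (r%:R - \tr (P *m Q)).
  have -> : Q *m G = (G^T *m ((1%:M - P) *m Q))^T.
    have GP : G^T *m P = 0 by rewrite /P /colproj 2!mulmxA GA !mul0mx.
    by rewrite mulmxA mulmxBr mulmx1 GP subr0 trmx_mul trmxK Qt.
  rewrite trace_inner_tr -[leLHS]mul1r.
  apply: le_trans (@trace_inner_mull_le R _ _ _ _ G^T 1%:M ((1%:M - P) *m Q) 1 s _) _.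
    by move=> u; rewrite mul1r mul1mx; exact: hG.
  rewrite mul1mx trace_inner_proj // ler_wpM2l //.
  by rewrite mulmxBl mul1mx raddfB /= mxtrace_colproj // lerD2r ler_nat.
(* The same quantity bounds from below what [X'] misses of [X]: it is the squared norm of [P *m N],
   whose columns lie in the column space of [A], where [hX] applies. *)
have HX : s * (r%:R - \tr (P *m Q)) <= trace_inner (N *m X) (N *m X).
  have -> : N *m X = (X^T *m (A *m (invmx (A^T *m A) *m A^T *m N)))^T.
    have -> : X^T *m (A *m (invmx (A^T *m A) *m A^T *m N)) = X^T *m N.
      rewrite /X trmx_mul trmxK -!mulmxA (mulmxA A^T A) (mulmxA (A^T *m A)).
      by rewrite mulmxV ?gram_unit // mul1mx.
    by rewrite trmx_mul trmxK Nt.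
  have -> : r%:R - \tr (P *m Q) = trace_inner (P *m N) (P *m N).
    by rewrite trace_inner_proj // mulmxBr mulmx1 raddfB /= mxtrace_colproj.
  have -> : P *m N = A *m (invmx (A^T *m A) *m A^T *m N) by rewrite !mulmxA.
  rewrite trace_inner_tr mulmxA -[leRHS]mul1r.
  by apply: trace_inner_mull_le => u; rewrite mul1r -mulmxA; exact: hX.
(* Dropping the [Q] part of the new error leaves [|N X|^2 + |N G|^2], which is at least
   [|Q G|^2 + |N G|^2 = |G|^2]. *)
have := trace_inner_ge0 (Q *m (X' - (X - G))).
lra.
Qed.

Lemma full_rank_mul_eq0 {R : realType} {p k} (A : 'M[R]_(p, k)) (c : 'cV_k) :
  \rank A = k -> (A *m c == 0) = (c == 0).
Proof.
move=> rA; apply/eqP/eqP => [Ac0|->]; last by rewrite mulmx0.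
by rewrite -(mulKmx (gram_unit _ rA) c) -mulmxA Ac0 !mulmx0.
Qed.

(* Tested on rank-one directions, the hypothesis bounds every Rayleigh quotient
   of [G G^T] by every Rayleigh quotient of [X X^T] on the column space of [A]. *)
Lemma factored_curvature_best_approx {R : realType} {m n r}
    (A : 'M[R]_(m, r)) (B : 'M[R]_(n, r)) (G : 'M[R]_(m, n)) :
    (0 < r)%N -> \rank A = r -> G *m B = 0 -> G^T *m A = 0 ->
    (forall U V, 0 <= trace_inner (U *m B^T + A *m V^T) (U *m B^T + A *m V^T) +
       2 * trace_inner G (U *m V^T)) ->
  best_rank_approx r (A *m B^T - G) (A *m B^T).
Proof.
move=> r0 rA GB GA hUV; set X := A *m B^T.
have key (c : 'cV_r) (u : 'cV_m) :
    trace_inner (A *m c) (A *m c) * trace_inner (G^T *m u) (G^T *m u) <=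
    trace_inner u u * trace_inner (X^T *m (A *m c)) (X^T *m (A *m c)).
  set x := A *m c; set v := G^T *m u; set a := A^T *m x.
  have Ba : X^T *m x = B *m a by rewrite /X trmx_mul trmxK -mulmxA.
  have ac : trace_inner a c = trace_inner x x by rewrite /a trace_inner_mull trmxK.
  (* With this choice the two parts of the first-order term are orthogonal because [G *m B = 0], and
     the hypothesis becomes [|u|^2 |X^T x|^2 + |x|^2 |v|^2 - 2 |x|^2 |v|^2 >= 0]. *)
  have := hUV (- (u *m a^T)) (v *m c^T).
  have -> : - (u *m a^T) *m B^T = - (u *m (B *m a)^T).
    by rewrite mulNmx -mulmxA -trmx_mul.
  have -> : A *m (v *m c^T)^T = x *m v^T by rewrite trmx_mul trmxK mulmxA.
  have -> : - (u *m a^T) *m (v *m c^T)^T = - trace_inner a c *: (u *m v^T).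
    rewrite (trmx_mul v) trmxK mulNmx mulmxA -(mulmxA u) [a^T *m c]mx11_scalar.
    by rewrite mul_mx_scalar -scalemxAl scaleNr /trace_inner /mxtrace big_ord1.
  have Bav : trace_inner (B *m a) v = 0.
    rewrite trace_innerC /v trace_inner_mull trmxK mulmxA GB mul0mx.
    exact: trace_inner0r.
  have Gv : trace_inner G (u *m v^T) = trace_inner v v.
    by rewrite trace_innerC trace_inner_mull -trace_inner_tr trmxK trmx_mul trmxK.
  rewrite trace_innerZr Gv trace_innerDl !trace_innerDr !trace_innerNl.
  rewrite !trace_innerNr !trace_inner_col_row (trace_innerC v) Bav -Ba ac.
  by lra.
(* The Rayleigh quotient of [G *m G^T]; division by zero gives [q 0 = 0]. *)
pose q (u : 'cV_m) := trace_inner (G^T *m u) (G^T *m u) / trace_inner u u.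
have gt0 k (w : 'cV[R]_k) : w != 0 -> 0 < trace_inner w w.
  by move=> w0; rewrite lt_def trace_inner_ge0 trace_inner_eq0 w0.
have qle (c : 'cV_r) u : A *m c != 0 ->
    q u <= trace_inner (X^T *m (A *m c)) (X^T *m (A *m c)) /
           trace_inner (A *m c) (A *m c).
  move=> Ac0; have [->|u0] := eqVneq u 0.
    by rewrite /q trace_inner0r invr0 mulr0 divr_ge0 ?trace_inner_ge0.
  rewrite /q ler_pdivrMr; last exact: gt0.
  rewrite mulrAC ler_pdivlMr; last exact: gt0.
  by rewrite mulrC [leRHS]mulrC; exact: key.
(* One nonzero vector [A *m c] is enough to bound [q] from above; it exists since [0 < r]. *)
have [c0 Ac0] : exists c : 'cV_r, A *m c != 0.
  exists (const_mx 1); rewrite full_rank_mul_eq0 //; apply/eqP => /matrixP.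
  by move/(_ (Ordinal r0) 0)/eqP; rewrite !mxE oner_eq0.
have ubq : has_ubound (range q).
  by eexists => _ [u _ <-]; exact: qle Ac0.
have qsup u : q u <= sup (range q) by apply: ub_le_sup => //; exists u.
(* The separating value is the supremum of [q], the square of the largest singular value of [G]. *)
apply: (spectral_gap_best_approx _ _ _ (sup (range q))) => //.
- by apply: le_trans (qsup 0); rewrite divr_ge0 ?trace_inner_ge0.
- move=> u; have [->|u0] := eqVneq u 0; first by rewrite mulmx0 !trace_inner0r mulr0.
  by rewrite -ler_pdivrMr ?gt0 //; exact: qsup.
- move=> c; have [->|Ac] := eqVneq (A *m c) 0; first by rewrite mulmx0 !trace_inner0r mulr0.
  rewrite -ler_pdivlMr ?gt0 //; apply: ge_sup => [|_ [u _ <-]]; last exact: qle.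
  by exists (q 0), 0.
Qed.

(** * Differential calculus for matrix-valued maps *)

Lemma is_derive_mx {R : realType} {V : normedModType R} {p q}
    (M : V -> 'M[R]_(p, q)) (dM : 'M[R]_(p, q)) (x v : V) :
  (forall i j, is_derive x v (fun y => M y i j) (dM i j)) -> is_derive x v M dM.
Proof.
move=> dMij; have dM' : derivable M x v by apply/derivable_mxP => i j.
apply: DeriveDef => //; rewrite derive_mx //.
by apply/matrixP => i j; rewrite mxE derive_val.
Qed.

Lemma is_derive_coord {R : realType} {V : normedModType R} {p q}
    (M : V -> 'M[R]_(p, q)) (dM : 'M[R]_(p, q)) (x v : V) i j :
  is_derive x v M dM -> is_derive x v (fun y => M y i j) (dM i j).
Proof.
move=> dMx; have /derivable_mxP dMij : derivable M x v by [].
by apply: DeriveDef => //; rewrite -(@derive_val _ _ _ _ _ _ _ dMx) derive_mx // mxE.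
Qed.

Lemma is_derive_trace_inner {R : realType} {V : normedModType R} {p q}
    (M N : V -> 'M[R]_(p, q)) (dM dN : 'M[R]_(p, q)) (x v : V) :
  is_derive x v M dM -> is_derive x v N dN ->
  is_derive x v (fun y => trace_inner (M y) (N y))
    (trace_inner dM (N x) + trace_inner (M x) dN).
Proof.
move=> dMx dNx.
have -> : (fun y => trace_inner (M y) (N y)) =
    \sum_i \sum_j (fun y => M y i j) * (fun y => N y i j).
  apply/funext => y; rewrite trace_innerE fct_sumE; apply: eq_bigr => i _.
  by rewrite fct_sumE.
rewrite !trace_innerE -big_split /=.
apply: is_derive_sum => i; rewrite -big_split /=.
apply: is_derive_sum => j.
have dMij := is_derive_coord _ _ _ _ i j dMx.
have dNij := is_derive_coord _ _ _ _ i j dNx.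
apply: is_derive_eq; rewrite /GRing.scale /=. ring.
Qed.

Lemma is_derive_comp_curve {R : realType} {V W : normedModType R}
    (F : V -> W) (c : R -> V) (dc : V) (t : R) :
  differentiable F (c t) -> is_derive t 1 c dc ->
  is_derive t 1 (fun h => F (c h)) ('d F (c t) dc).
Proof.
move=> dF dcx; have dct : differentiable c t by apply/derivable1_diffP.
have dFc : differentiable (F \o c) t by exact: differentiable_comp.
apply: DeriveDef; first exact/derivable1_diffP.
rewrite (_ : (fun h => F (c h)) = F \o c) // deriveE // diff_comp //=.
by rewrite -(@deriveE _ _ _ c) // derive_val.
Qed.

Lemma is_derive_line {R : realType} {V : normedModType R} (x v : V) (t : R) :
  is_derive t 1 (fun h : R => h *: v + x) v.
Proof.
have dh : is_diff t (fun h : R => h *: v + x) ( *:%R^~ v).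
  by apply: (@is_diff_eq _ _ _ _ ( *:%R^~ v + 0)); rewrite addr0.
apply: DeriveDef; first exact/derivable1_diffP.
by rewrite deriveE // diff_val scale1r.
Qed.

Lemma is_derive_quadratic_mx {R : realType} {p q} (X D E : 'M[R]_(p, q)) (t : R) :
  is_derive t 1 (fun h : R => X + h *: D + h ^+ 2 *: E) (D + (2 * t) *: E).
Proof.
apply: is_derive_mx => i j.
rewrite (_ : (fun y => _) =
  cst (X i j) + D i j *: (id : R -> R) + E i j *: (id : R -> R) ^+ 2); last first.
  apply/funext => h; rewrite !mxE.
  rewrite !fctE /GRing.scale /=; ring.
apply: is_derive_eq; rewrite !mxE /GRing.scale /=. ring.
Qed.

Lemma differentiable_mx {R : realType} {V : normedModType R} {p q}
    (F : V -> 'M[R]_(p, q)) (x : V) :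
  (forall i j, differentiable (fun y => F y i j) x) -> differentiable F x.
Proof.
move=> dF; have -> : F = \sum_i \sum_j (fun y => F y i j *: delta_mx i j).
  apply/funext => y; rewrite {1}(matrix_sum_delta (F y)) fct_sumE.
  by apply: eq_bigr => i _; rewrite fct_sumE.
apply: differentiable_sum => i; apply: differentiable_sum => j.
exact: differentiableZl.
Qed.

Lemma differentiable_entry {R : realType} {V : normedModType R} {p q}
    (F : V -> 'M[R]_(p, q)) (x : V) i j :
  differentiable F x -> differentiable (fun y => F y i j) x.
Proof.
move=> dF; apply: (differentiable_comp (g := fun N : 'M[R]_(p, q) => N i j) dF).
exact: differentiable_coord.
Qed.

Lemma differentiable_mulmx {R : realType} {V : normedModType R} {p q k}
    (F : V -> 'M[R]_(p, q)) (H : V -> 'M[R]_(q, k)) (x : V) :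
  differentiable F x -> differentiable H x ->
  differentiable (fun y => F y *m H y) x.
Proof.
move=> dF dH; apply: differentiable_mx => i j.
rewrite (_ : (fun y => _) = \sum_l (fun y => F y i l) * (fun y => H y l j)).
  by apply: differentiable_sum => l; apply: differentiableM; exact: differentiable_entry.
by apply/funext => y; rewrite mxE fct_sumE.
Qed.

Lemma differentiable_trmx {R : realType} {V : normedModType R} {p q}
    (F : V -> 'M[R]_(p, q)) (x : V) :
  differentiable F x -> differentiable (fun y => (F y)^T) x.
Proof.
move=> dF; apply: differentiable_mx => i j.
rewrite (_ : (fun y => _) = fun y => F y j i); first exact: differentiable_entry.
by apply/funext => y; rewrite mxE.
Qed.

Lemma differentiable_fst {R : realType} {V W : normedModType R} (x : V * W) :
  differentiable (fun y : V * W => y.1) x.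
Proof.
by apply: (@linear_differentiable _ _ _ fst) => y; exact: cvg_fst.
Qed.

Lemma differentiable_snd {R : realType} {V W : normedModType R} (x : V * W) :
  differentiable (fun y : V * W => y.2) x.
Proof.
by apply: (@linear_differentiable _ _ _ snd) => y; exact: cvg_snd.
Qed.

(** * Gradient and Hessian of the factored function *)

Lemma trace_inner_delta {R : realType} {p q} (M : 'M[R]_(p, q)) i j :
  trace_inner M (delta_mx i j) = M i j.
Proof.
rewrite trace_innerE (bigD1 i) //= (bigD1 j) //= !mxE !eqxx mulr1.
rewrite big1 => [|k kj]; last by rewrite mxE (negPf kj) andbF mulr0.
rewrite addr0 big1 ?addr0 // => k ki.
by rewrite big1 // => l _; rewrite mxE (negPf ki) mulr0.
Qed.

Lemma diff_gradE {R : realType} {p q} (f : 'M[R]_(p, q) -> R) (X H : 'M[R]_(p, q)) :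
  differentiable f X -> 'd f X H = trace_inner (grad f X) H.
Proof.
move=> df; rewrite {1}(matrix_sum_delta H) linear_sum trace_innerE.
apply: eq_bigr => i _; rewrite linear_sum; apply: eq_bigr => j _.
by rewrite linearZ /= mxE deriveE // mulrC.
Qed.

(** Linearity of [L] makes the two difference quotients the same function, so their limits agree. *)
Lemma derive_comp_linear {R : realType} {U V W : normedModType R}
    (L : {linear U -> V}) (f : V -> W) (x v : U) :
  'D_v (fun y => f (L y)) x = 'D_(L v) f (L x).
Proof. by congr lim; rewrite /=; under eq_fun do rewrite linearP. Qed.

(** Each partial map is [f] after a linear map, so its gradient is the adjoint of that map applied
    to [G]; pairing with elementary matrices reads off the entries. *)
Lemma grad2_factored {R : realType} {m n r} (f : 'M[R]_(m, n) -> R)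
    (P : 'M[R]_(m, r) * 'M[R]_(n, r)) (G := grad f (P.1 *m P.2^T)) :
  differentiable f (P.1 *m P.2^T) ->
  grad2 (factored f) P = (G *m P.2, G^T *m P.1).
Proof.
move=> df; rewrite /grad2 /factored /=; congr pair.
- apply/matrixP => i j; rewrite mxE.
  rewrite (derive_comp_linear (mulmxr P.2^T) f) deriveE //= diff_gradE //.
  by rewrite -/G -trace_inner_delta trace_inner_mulr.
- apply/matrixP => i j; rewrite mxE.
  rewrite (derive_comp_linear (mulmx P.1 \o trmx) f) deriveE //= diff_gradE //.
  rewrite -/G -[RHS]trace_inner_delta trace_inner_mull trmxK.
  by rewrite trace_innerC trace_inner_mulr trmxK.
Qed.

Lemma grad2_factored_dot {R : realType} {m n r} (f : 'M[R]_(m, n) -> R)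
    (A U : 'M[R]_(m, r)) (B V : 'M[R]_(n, r)) (G := grad f (A *m B^T)) :
  trace_inner (G *m B) U + trace_inner (G^T *m A) V =
  trace_inner G (U *m B^T + A *m V^T).
Proof.
rewrite trace_inner_mulr trace_innerDr; congr (_ + _).
by rewrite trace_inner_mull [RHS]trace_innerC trace_inner_mulr !trmxK.
Qed.

Lemma factored_curve {R : realType} {m n r}
    (A U : 'M[R]_(m, r)) (B V : 'M[R]_(n, r)) (h : R) :
  (h *: U + A) *m (h *: V + B)^T =
  A *m B^T + h *: (U *m B^T + A *m V^T) + h ^+ 2 *: (U *m V^T).
Proof.
rewrite raddfD /= linearZ /= mulmxDl !mulmxDr -!scalemxAl -!scalemxAr scalerA.
by rewrite -expr2 scalerDr [LHS](AC (2*2) (4*(2*3)*1)).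
Qed.

Lemma factored_curve_velocity {R : realType} {m n r}
    (A U : 'M[R]_(m, r)) (B V : 'M[R]_(n, r)) (h : R) :
  U *m (h *: V + B)^T + (h *: U + A) *m V^T =
  U *m B^T + A *m V^T + (2 * h) *: (U *m V^T).
Proof.
rewrite raddfD /= linearZ /= mulmxDl mulmxDr -!scalemxAl -!scalemxAr.
rewrite mulr_natl mulr2n scalerDl.
by rewrite [LHS](AC (2*2) ((2*4)*(1*3))).
Qed.

(** The product rule for the derivative of [f] along a curve with velocity [D] and acceleration
    [2 *: E] at 0. Both the Hessian formula and the Taylor expansion rest on it. *)
Lemma is_derive_grad_quadratic_curve {R : realType} {p q} (f : 'M[R]_(p, q) -> R)
    (X D E : 'M[R]_(p, q)) :
  differentiable (grad f) X ->
  is_derive (0 : R) 1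
    (fun h => trace_inner (grad f (X + h *: D + h ^+ 2 *: E)) (D + (2 * h) *: E))
    (trace_inner ('d (grad f) X D) D + 2 * trace_inner (grad f X) E).
Proof.
move=> dG; pose Y (h : R) := X + h *: D + h ^+ 2 *: E.
have Y0 : Y 0 = X by rewrite /Y expr0n !scale0r !addr0.
have dY : is_derive (0 : R) 1 Y D.
  by have := is_derive_quadratic_mx X D E 0; rewrite mulr0 scale0r addr0.
have dvel : is_derive (0 : R) 1 (fun h : R => D + (2 * h) *: E) (2 *: E).
  rewrite (_ : (fun h : R => _) = fun h : R => h *: (2 *: E) + D).
    exact: is_derive_line.
  by apply/funext => h; rewrite scalerA mulrC addrC.
have dGY := is_derive_comp_curve (grad f) Y D 0; rewrite Y0 in dGY.
have := is_derive_trace_inner _ _ _ _ _ _ (dGY dG dY) dvel.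
by rewrite Y0 mulr0 scale0r addr0 trace_innerZr.
Qed.

(** The Hessian form is the derivative at 0 of the gradient of the factored function along
    [P + h W], paired with [W]. That pairing is the derivative of [f] along the quadratic curve
    [h |-> (A + h U)(B + h V)^T]. *)
Lemma hess2_factored {R : realType} {m n r} (f : 'M[R]_(m, n) -> R)
    (A U : 'M[R]_(m, r)) (B V : 'M[R]_(n, r))
    (X := A *m B^T) (D := U *m B^T + A *m V^T) :
  twice_differentiable f ->
  hess2 (factored f) (A, B) (U, V) =
  trace_inner ('d (grad f) X D) D + 2 * trace_inner (grad f X) (U *m V^T).
Proof.
move=> hf; pose P := (A, B); pose W := (U, V).
pose F1 (Q : 'M[R]_(m, r) * 'M[R]_(n, r)) := grad f (Q.1 *m Q.2^T) *m Q.2.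
pose F2 (Q : 'M[R]_(m, r) * 'M[R]_(n, r)) := (grad f (Q.1 *m Q.2^T))^T *m Q.1.
have gradE : grad2 (factored f) = fun Q => (F1 Q, F2 Q).
  by apply/funext => Q; rewrite grad2_factored //; have [] := hf (Q.1 *m Q.2^T).
have dfst (Q : 'M[R]_(m, r) * 'M[R]_(n, r)) := differentiable_fst Q.
have dsnd (Q : 'M[R]_(m, r) * 'M[R]_(n, r)) := differentiable_snd Q.
have dG Q : differentiable (fun Q : 'M[R]_(m, r) * 'M[R]_(n, r) =>
    grad f (Q.1 *m Q.2^T)) Q.
  apply: (differentiable_comp (f := fun Q => Q.1 *m Q.2^T) (g := grad f)).
    by apply: differentiable_mulmx => //; exact: differentiable_trmx.
  by have [] := hf (Q.1 *m Q.2^T).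
have dF1 Q : differentiable F1 Q by exact: differentiable_mulmx.
have dF2 Q : differentiable F2 Q.
  by apply: differentiable_mulmx => //; exact: differentiable_trmx.
pose c (h : R) := h *: W + P.
have c0 : c 0 = P by rewrite /c scale0r add0r.
have dc := is_derive_line P W (0 : R).
have dk := @is_deriveD _ _ _ _ _ _ _ _ _
  (is_derive_trace_inner _ _ _ _ _ _
    (is_derive_comp_curve F1 c W 0 (dF1 _) dc) (is_derive_cst U (0 : R) 1))
  (is_derive_trace_inner _ _ _ _ _ _
    (is_derive_comp_curve F2 c W 0 (dF2 _) dc) (is_derive_cst V (0 : R) 1)).
have -> : hess2 (factored f) (A, B) (U, V) =
    trace_inner ('d F1 P W) U + trace_inner ('d F2 P W) V.
  by rewrite /hess2 gradE diff_pair.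
move: dk; rewrite c0 !trace_inner0r !addr0 => dk.
rewrite -(@derive_val _ _ _ _ _ _ _ dk).
have -> : ((fun y => trace_inner (F1 (c y)) (cst U y)) +
    (fun y => trace_inner (F2 (c y)) (cst V y))) =
    fun h : R => trace_inner (grad f (X + h *: D + h ^+ 2 *: (U *m V^T)))
      (D + (2 * h) *: (U *m V^T)).
  apply/funext => h; rewrite fctE grad2_factored_dot.
  by rewrite factored_curve_velocity factored_curve.
exact: (@derive_val _ _ _ _ _ _ _ (is_derive_grad_quadratic_curve _ _ _ _ (hf _).2)).
Qed.

(** * Second-order expansion along quadratic curves *)

(** The second derivative exists only at 0, so the mean value theorem is applied to [phi] minus its
    quadratic term: the derivative [dphi s - k * s] is small compared with [s], and [s < t]. *)
Lemma taylor2_peano {R : realType} (phi dphi : R -> R) (k e : R) :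
  (forall t : R, is_derive t 1 phi (dphi t)) -> dphi 0 = 0 ->
  is_derive (0 : R) 1 dphi k -> 0 < e ->
  \forall t \near (0 : R)^'+, `|phi t - phi 0 - k / 2 * t ^+ 2| <= e * t ^+ 2.
Proof.
move=> dphiE dphi0 dk e0.
have lim_k : h^-1 *: ((dphi \o shift 0) (h *: 1) - dphi 0) @[h --> (0 : R)^'] --> k.
  by rewrite -(@derive_val _ _ _ _ _ _ _ dk); exact: (@ex_derive _ _ _ _ _ _ _ dk).
move/cvgrPdist_le : lim_k => /(_ _ e0) [d /= d0 hd].
near=> t; have t0 : 0 < t by [].
have td : t < d by near: t; exact: nbhs_right_lt.
pose psi : R -> R := phi - (k / 2) *: (id : R -> R) ^+ 2.
have dpsi (s : R) : is_derive s 1 psi (dphi s - k * s).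
  have dphis := dphiE s.
  by apply: is_derive_eq; rewrite /GRing.scale /=; field.
have cpsi : {within `[0, t], continuous psi}.
  apply: continuous_subspaceT => s.
  by apply: differentiable_continuous; exact/derivable1_diffP.
have [s] := MVT t0 (fun s _ => dpsi s) cpsi.
rewrite in_itv /= => /andP[s0 st].
rewrite /psi !fctE /GRing.scale /= expr0n /= mulr0 !subr0 => E.
have -> : phi t - phi 0 - k / 2 * t ^+ 2 = (dphi s - k * s) * t by rewrite -E; ring.
have /= := hd s; rewrite sub0r normrN gtr0_norm // (lt_trans st td) gt_eqF //.
move=> /(_ isT isT); rewrite dphi0 subr0 /GRing.scale /= mulr1 addr0 => hs.
rewrite normrM (gtr0_norm t0) expr2 mulrA; apply: ler_wpM2r; first exact: ltW.
have -> : dphi s - k * s = - (s * (k - s^-1 * dphi s)).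
  by field; rewrite gt_eqF.
rewrite normrN normrM gtr0_norm // mulrC.
by apply: ler_pM => //; exact: ltW.
Unshelve. all: by end_near. Qed.

Lemma taylor2_quadratic_curve {R : realType} {p q} (f : 'M[R]_(p, q) -> R)
    (X D E : 'M[R]_(p, q)) (e : R)
    (k := trace_inner ('d (grad f) X D) D + 2 * trace_inner (grad f X) E) :
  twice_differentiable f -> trace_inner (grad f X) D = 0 -> 0 < e ->
  \forall t \near (0 : R)^'+,
    `|f (X + t *: D + t ^+ 2 *: E) - f X - k / 2 * t ^+ 2| <= e * t ^+ 2.
Proof.
move=> hf GD e0; pose Y (h : R) := X + h *: D + h ^+ 2 *: E.
have Y0 : Y 0 = X by rewrite /Y expr0n !scale0r !addr0.
have dphi t := is_derive_comp_curve f Y _ t (hf _).1 (is_derive_quadratic_mx X D E t).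
have := taylor2_peano (fun h => f (Y h)) _ k e dphi.
rewrite Y0; apply => //.
  by rewrite mulr0 scale0r addr0 diff_gradE //; exact: (hf X).1.
rewrite (_ : (fun t => _) =
  fun h => trace_inner (grad f (X + h *: D + h ^+ 2 *: E)) (D + (2 * h) *: E)).
  exact/is_derive_grad_quadratic_curve/(hf X).2.
by apply/funext => h; rewrite diff_gradE //; exact: (hf _).1.
Qed.

(** * Consequences of the local curvature bound *)

Lemma frob_norm_sqr {R : realType} {p q} (M : 'M[R]_(p, q)) :
  frob_norm M ^+ 2 = trace_inner M M.
Proof. by rewrite sqr_sqrtr // trace_inner_ge0. Qed.

Lemma frob_normN {R : realType} {p q} (M : 'M[R]_(p, q)) :
  frob_norm (- M) = frob_norm M.
Proof. by rewrite /frob_norm trace_innerNl trace_innerNr opprK. Qed.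

(** The supremum over a ball is monotone in the radius, so its right limit at 0 exists. This limit
    is at most [eta^-1], and the slack [d] makes the bound hold already at some positive radius. *)
Lemma beta_local_bound {R : realType} {m n r} (f : 'M[R]_(m, n) -> R)
    (X : 'M[R]_(m, n)) (eta d : R) :
  0 < eta -> (eta%:E <= (beta_local r f X)^-1)%E -> 0 < d ->
  exists2 eps : R, 0 < eps & forall Y, frob_norm (Y - X) <= eps ->
    (\rank Y <= r)%N ->
    f Y - f X - trace_inner (grad f X) (Y - X) <=
      (eta^-1 + d) / 2 * trace_inner (Y - X) (Y - X).
Proof.
move=> eta0 hbeta d0; pose S eps := ereal_sup
  [set (curvature_quotient f X Y)%:E | Y in
     [set Y : 'M[R]_(m, n) | 0 < frob_norm (Y - X) <= eps /\ (\rank Y <= r)%N]].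
(* Inversion preserves sign, so the curvature is nonnegative, and there inversion reverses the
   order; the value [0^-1 = +oo] is included. *)
have beta_le : (beta_local r f X <= (eta^-1)%:E)%E.
  have beta0 : (0 <= beta_local r f X)%E.
    by rewrite -inve_ge0 (le_trans _ hbeta) // lee_fin ltW.
  move: hbeta; rewrite inve_pge ?inE ?lee_fin ?(ltW eta0) //.
  by rewrite inver (gt_eqF eta0).
have S_nd : {homo S : x y / x <= y >-> (x <= y)%E}.
  move=> x y xy; apply: ereal_sup_le => _ [Y [/andP[Y0 Yx] rY] <-].
  exists Y => //; split=> //.
  by rewrite Y0 (le_trans Yx).
have S_cvg : S x @[x --> (0 : R)^'+] --> beta_local r f X.
  apply: nondecreasing_at_right_is_cvge; near=> x => y z _ _; exact: S_nd.
have beta_lt : (beta_local r f X < (eta^-1 + d)%:E)%E.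
  by rewrite (le_lt_trans beta_le) // lte_fin ltrDl.
have S_lt : \forall x \near (0 : R)^'+, (S x < (eta^-1 + d)%:E)%E.
  exact: (S_cvg _ (open_ereal_lt' beta_lt)).
near (0 : R)^'+ => x; exists x => // Y Yx rY.
(* The supremum leaves out [Y = X], where both sides vanish. *)
have [->|YX] := eqVneq Y X.
  by rewrite !subrr !trace_inner0r subr0 mulr0.
have N0 : 0 < trace_inner (Y - X) (Y - X).
  by rewrite lt_def trace_inner_ge0 trace_inner_eq0 subr_eq0 YX.
have : ((curvature_quotient f X Y)%:E <= S x)%E.
  apply: ereal_sup_ubound; exists Y => //; split=> //.
  by rewrite Yx andbT sqrtr_gt0.
have Sx : (S x < (eta^-1 + d)%:E)%E by near: x.
move=> /le_lt_trans/(_ Sx); rewrite lte_fin /curvature_quotient.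
rewrite -(opprB Y X) frob_normN frob_norm_sqr ltr_pdivrMr ?mulr_gt0 ?invr_gt0 //.
by rewrite mulrA => /ltW.
Unshelve. all: by end_near. Qed.

Lemma quadratic_curve_cvg {R : realType} {p q} (X D E : 'M[R]_(p, q)) :
  X + h *: D + h ^+ 2 *: E @[h --> (0 : R)] --> X.
Proof.
have dY := is_derive_quadratic_mx X D E 0.
have : {for (0 : R), continuous (fun h : R => X + h *: D + h ^+ 2 *: E)}.
  by apply: differentiable_continuous; exact/derivable1_diffP.
by rewrite /prop_for /continuous_at expr0n !scale0r !addr0.
Qed.

(** Along the curve, [f] grows by at least [- e t^2] by Taylor and by at most [t^2 <G, E> + (1 + e)
    / (2 eta) t^2 |D + t E|^2] by curvature, with [G = grad f X]. Dividing by [t^2] and letting [t],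
    then [e], tend to 0 gives the claim. *)
Lemma beta_local_curve {R : realType} {m n r} (f : 'M[R]_(m, n) -> R)
    (X D E : 'M[R]_(m, n)) (eta : R) :
    twice_differentiable f -> 0 < eta ->
    (eta%:E <= (beta_local r f X)^-1)%E ->
    (forall t : R, (\rank (X + t *: D + t ^+ 2 *: E)%R <= r)%N) ->
    trace_inner (grad f X) D = 0 ->
    0 <= trace_inner ('d (grad f) X D) D + 2 * trace_inner (grad f X) E ->
  0 <= trace_inner D D + 2 * eta * trace_inner (grad f X) E.
Proof.
move=> hf eta0 hbeta rY GD; set k := (X in 0 <= X) => k0.
set a := trace_inner D D; set g := trace_inner _ E.
have a0 : 0 <= a by exact: trace_inner_ge0.
have key e : 0 < e -> - (a + 2 * eta * g) <= e * (1 + a + e + 2 * eta).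
  move=> e0.
  have [eps eps0 heps] := beta_local_bound f X eta (e / eta) eta0 hbeta (divr_gt0 e0 eta0).
  pose N (h : R) := trace_inner (D + h *: E) (D + h *: E).
  have YX h : X + h *: D + h ^+ 2 *: E - X = h *: (D + h *: E).
    by rewrite [LHS](ACl (1*4*(2*3))) /= subrr add0r scalerDr scalerA -expr2.
  have Ncvg : N h @[h --> (0 : R)^'+] --> a.
    have N0 : N 0 = a by rewrite /N scale0r addr0.
    have dN := is_derive_line D E (0 : R).
    have {}dN := is_derive_trace_inner _ _ _ _ _ _ dN dN.
    have cN : {for (0 : R), continuous N}.
      rewrite (_ : N = fun h : R => trace_inner (h *: E + D) (h *: E + D)).
        by apply: differentiable_continuous; exact/derivable1_diffP.
      by apply/funext => h; rewrite /N addrC.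
    by apply: cvg_at_right_filter; rewrite -N0; exact: cN.
  have ae0 : 0 < a + e by lra.
  near (0 : R)^'+ => t.
  have t0 : 0 < t by [].
  have Nt : N t <= a + e.
    by near: t; apply: (cvgr_le _ Ncvg); rewrite ltrDl.
  (* Keeps the curve point within distance [eps] of [X]: [t <= 1] gives [t ^+ 2 <= t], and [t] is
     also below [eps ^+ 2 / (a + e)]. *)
  have tN : t ^+ 2 * N t <= eps ^+ 2.
    have : t ^+ 2 <= eps ^+ 2 / (a + e).
      have t1 : t <= 1 by near: t; exact: nbhs_right_le.
      apply: (le_trans (y := t)); first by rewrite expr2 ler_piMr // ltW.
      by near: t; apply: nbhs_right_le; rewrite divr_gt0 ?exprn_gt0.
    rewrite ler_pdivlMr; last exact: ae0.
    by apply: le_trans; rewrite ler_wpM2l // sqr_ge0.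
  have := heps (X + t *: D + t ^+ 2 *: E); rewrite YX.
  have Nt2 : trace_inner (t *: (D + t *: E)) (t *: (D + t *: E)) = t ^+ 2 * N t.
    by rewrite trace_innerZl trace_innerZr mulrA -expr2.
  rewrite {1}/frob_norm Nt2.
  have -> : Num.sqrt (t ^+ 2 * N t) <= eps.
    by rewrite -(gtr0_norm eps0) -sqrtr_sqr ler_wsqrtr.
  rewrite rY => /(_ isT isT).
  rewrite trace_innerZr trace_innerDr trace_innerZr GD add0r -/g.
  have : `|f (X + t *: D + t ^+ 2 *: E) - f X - k / 2 * t ^+ 2| <= e * t ^+ 2.
    by near: t; exact: taylor2_quadratic_curve.
  rewrite ler_norml => /andP[taylor _] bound.
  have t2 : 0 < t ^+ 2 by rewrite exprn_gt0.
  have {taylor bound} : - e - g <= (eta^-1 + e / eta) / 2 * N t.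
    rewrite -(ler_pM2r t2); have : 0 <= k / 2 * t ^+ 2 by rewrite mulr_ge0 ?divr_ge0 // ltW.
    move: taylor bound; rewrite /=; lra.
  have -> : eta^-1 + e / eta = (1 + e) / eta by field; rewrite gt_eqF.
  move=> H.
  have : (1 + e) / eta / 2 * N t <= (1 + e) / eta / 2 * (a + e).
    by rewrite ler_wpM2l // !divr_ge0 // ?ltW //; lra.
  move=> /(le_trans H); rewrite -(ler_pM2l (mulr_gt0 (ltr0Sn R 1) eta0)).
  have -> : 2 * eta * ((1 + e) / eta / 2 * (a + e)) = (1 + e) * (a + e).
    by field; rewrite gt_eqF.
  by lra.
rewrite leNgt; apply/negP => neg.
(* For [e <= 1], [key] gives [s <= e * (2 + a + 2 * eta)]. The [e] below makes the right side equal
   to [s - e * s], a contradiction. *)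
pose s := - (a + 2 * eta * g); have s0 : 0 < s by rewrite oppr_gt0.
have C0 : 0 < 2 + a + 2 * eta by lra.
have e0 : 0 < s / (s + (2 + a + 2 * eta)) by rewrite divr_gt0 // addr_gt0.
have := key _ e0; rewrite -/s; set e := s / _ in e0 *.
have eE : e * s + e * (2 + a + 2 * eta) = s.
  by rewrite -mulrDr divfK // gt_eqF // addr_gt0.
have e1 : e <= 1.
  rewrite leNgt; apply/negP => e1.
  have : s < e * s by rewrite ltr_pMl.
  by have := mulr_gt0 e0 C0; lra.
have ee : e * e <= e by rewrite ler_piMr // ltW.
have es : 0 < e * s by rewrite mulr_gt0.
lra.
Unshelve. all: by end_near. Qed.

(** * Stationarity, fixed points and local minima *)

Lemma quadratic_ge0_linear_eq0 {R : realType} (a b : R) :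
  (forall s, 0 <= s ^+ 2 * a + s * b) -> b = 0.
Proof.
move=> H; apply/eqP/negPn/negP => b0.
have c0 : 0 < `|a| + 1 by rewrite ltr_wpDl.
(* At this [s] the linear term outweighs the quadratic one whatever the sign of [a], and the [+ 1]
   also covers [a = 0]. *)
have := H (- b / (`|a| + 1)); apply/negP; rewrite -ltNge.
have -> : (- b / (`|a| + 1)) ^+ 2 * a + - b / (`|a| + 1) * b =
    (b / (`|a| + 1)) ^+ 2 * (a - `|a| - 1) by field; rewrite gt_eqF.
rewrite pmulr_rlt0; last by rewrite exprn_even_gt0 //= mulf_neq0 // invr_eq0 gt_eqF.
by have := ler_norm a; lra.
Qed.

Lemma rank_deficient_kernel {R : realType} {p k} (A : 'M[R]_(p, k)) :
  \rank A <> k -> exists2 w : 'cV_k, w != 0 & A *m w = 0.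
Proof.
move=> rA; exists (nz_row (kermx A^T))^T.
  rewrite -(inj_eq trmx_inj) trmxK trmx0 nz_row_eq0 kermx_eq0.
  by rewrite /row_free mxrank_tr; apply/eqP.
apply: trmx_inj; rewrite trmx_mul trmxK trmx0.
by apply/sub_kermxP; exact: nz_row_sub.
Qed.

(* Along [U = s u w^T], [V = v w^T] the first-order part of the curve is linear
   in [s], so the Hessian is [O(s^2) + 2 s |w|^2 <grad f X, u v^T>]. *)
Lemma hess2_ge0_kernel_grad_eq0 {R : realType} {m n r} (f : 'M[R]_(m, n) -> R)
    (A : 'M[R]_(m, r)) (B : 'M[R]_(n, r)) (w : 'cV_r) :
    twice_differentiable f -> (forall W, 0 <= hess2 (factored f) (A, B) W) ->
    w != 0 -> A *m w = 0 ->
  grad f (A *m B^T) = 0.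
Proof.
move=> hf hH w0 Aw; set G := grad f _.
(* Each entry of [G] is its pairing with a rank-one elementary matrix, which supplies [u] and
   [v]. *)
apply/matrixP => i j; rewrite [RHS]mxE -[LHS]trace_inner_delta.
have -> : delta_mx i j = delta_mx i (0 : 'I_1) *m (delta_mx j (0 : 'I_1))^T :> 'M[R]_(m, n).
  by rewrite trmx_delta mul_delta_mx.
move: (delta_mx i 0) (delta_mx j 0) => u v.
have ww : trace_inner w w != 0 by rewrite trace_inner_eq0.
set D := u *m (B *m w)^T; set g := trace_inner _ _.
have : 2 * trace_inner w w * g = 0.
  apply: (quadratic_ge0_linear_eq0 (trace_inner ('d (grad f) (A *m B^T) D) D)) => s.
  have := hH (s *: (u *m w^T), v *m w^T); rewrite hess2_factored //.
  have -> : s *: (u *m w^T) *m B^T + A *m (v *m w^T)^T = s *: D.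
    rewrite (trmx_mul v) trmxK (mulmxA A) Aw mul0mx addr0 -scalemxAl -mulmxA.
    by rewrite /D (trmx_mul B).
  have -> : s *: (u *m w^T) *m (v *m w^T)^T =
      (s * trace_inner w w) *: (u *m v^T).
    rewrite (trmx_mul v) trmxK -scalemxAl mulmxA -(mulmxA u) [w^T *m w]mx11_scalar.
    by rewrite mul_mx_scalar -scalemxAl scalerA /trace_inner /mxtrace big_ord1.
  rewrite linearZ /= trace_innerZl !trace_innerZr -/G -/g.
  by congr (0 <= _); ring.
by move/eqP; rewrite mulf_eq0 mulf_eq0 (negPf ww) pnatr_eq0 /= => /eqP.
Qed.

Lemma SOSP_pgd_fixed_point {R : realType} {m n r} (f : 'M[R]_(m, n) -> R)
    (A : 'M[R]_(m, r)) (B : 'M[R]_(n, r)) (eta : R) :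
    (0 < r)%N -> twice_differentiable f -> SOSP (factored f) (A, B) ->
    0 < eta -> (eta%:E <= (beta_local r f (A *m B^T))^-1)%E ->
  pgd_fixed_point r f eta (A *m B^T).
Proof.
move=> r0 hf [hg hH] eta0 hbeta; rewrite /pgd_fixed_point.
set X := A *m B^T; set G := grad f X.
have [GB GA] : G *m B = 0 /\ G^T *m A = 0.
  by move: hg; rewrite grad2_factored /=; [case | exact: (hf X).1].
(* Only the rank of [A] is split. If [B] alone is deficient, the smallest of the [r] leading
   singular values of [X] is 0, and the singular value inequality itself forces [G = 0]. *)
have [rA|/eqP rA] := eqVneq (\rank A) r; last first.
  have [w w0 Aw] := rank_deficient_kernel A rA.
  rewrite /G (hess2_ge0_kernel_grad_eq0 f A B w) // scaler0 subr0; split.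
    by apply: leq_trans (mxrankM_maxl _ _) (rank_leq_col _).
  by move=> X' _; rewrite subrr /frob_norm trace_inner0r sqrtr0 sqrtr_ge0.
apply: factored_curvature_best_approx => //.
- by rewrite -scalemxAl GB scaler0.
- by rewrite linearZ /= -scalemxAl GA scaler0.
move=> U V; rewrite trace_innerZl mulrA.
apply: (beta_local_curve (r := r) f X) => //.
- move=> t; rewrite -factored_curve.
  by apply: leq_trans (mxrankM_maxl _ _) (rank_leq_col _).
- by rewrite -grad2_factored_dot -/G GB GA !trace_inner0l addr0.
- by rewrite -hess2_factored.
Qed.

Lemma local_min_rank_SOSP {R : realType} {m n r} (f : 'M[R]_(m, n) -> R)
    (A : 'M[R]_(m, r)) (B : 'M[R]_(n, r)) :
  twice_differentiable f -> local_min_rank r f (A *m B^T) ->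
  SOSP (factored f) (A, B).
Proof.
move=> hf [_ hmin]; set X := A *m B^T in hmin *; set G := grad f X.
have curve_min U V : \forall h \near (0 : R),
    f X <= f (X + h *: (U *m B^T + A *m V^T) + h ^+ 2 *: (U *m V^T)).
  near=> h; set Y := X + _ + _.
  suff : (\rank Y <= r)%N -> f X <= f Y.
    apply; rewrite /Y -factored_curve.
    by apply: leq_trans (mxrankM_maxl _ _) (rank_leq_col _).
  rewrite /Y; near: h.
  exact: (quadratic_curve_cvg X (U *m B^T + A *m V^T) (U *m V^T) _ hmin).
have first_order U V : trace_inner G (U *m B^T + A *m V^T) = 0.
  set D := U *m B^T + _; set E := U *m V^T.
  pose Y (h : R) := X + h *: D + h ^+ 2 *: E.
  have Y0 : Y 0 = X by rewrite /Y expr0n !scale0r !addr0.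
  have dphi t := is_derive_comp_curve f Y _ t (hf _).1 (is_derive_quadratic_mx X D E t).
  have [/= d d0 hd] := curve_min U V.
  have dmin : is_derive (0 : R) 1 (fun h => f (Y h)) 0.
    (* Fermat's rule: 0 is an interior minimum of [f] along the curve. *)
    apply: (@derive1_at_min _ _ (- d) d).
    - by rewrite -subr_ge0 opprK addr_ge0 ?(ltW d0).
    - by move=> t _; exact: ex_derive.
    - by rewrite in_itv /= oppr_lt0 d0.
    - move=> t; rewrite in_itv /= => /andP[dt td]; rewrite Y0; apply: hd.
      by rewrite /= sub0r normrN ltr_norml dt.
  rewrite -diff_gradE; last exact: (hf X).1.
  rewrite -[RHS](@derive_val _ _ _ _ _ _ _ dmin) (@derive_val _ _ _ _ _ _ _ (dphi 0)).
  by rewrite Y0 mulr0 scale0r addr0.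
split.
- rewrite grad2_factored /=; last exact: (hf X).1.
  rewrite -/X -/G; congr pair.
    (* Each gradient component is tested against itself: [(G *m B, 0)] here, then
       [(0, G^T *m A)]. *)
    apply/eqP; rewrite -trace_inner_eq0 trace_inner_mulr; apply/eqP.
    by have := first_order (G *m B) 0; rewrite raddf0 mulmx0 addr0.
  apply/eqP; rewrite -trace_inner_eq0; apply/eqP.
  by have := first_order 0 (G^T *m A); rewrite -grad2_factored_dot trace_inner0r add0r.
- move=> [U V]; rewrite hess2_factored // -/X -/G leNgt; apply/negP.
  set k := (X in X < 0) => k0.
  near (0 : R)^'+ => t.
  have t0 : 0 < t by [].
  (* An error of [- k / 4] leaves at most [k / 4 * t ^+ 2 < 0] of the quadratic term
     [k / 2 * t ^+ 2], contradicting minimality. *)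
  have : `|f (X + t *: (U *m B^T + A *m V^T) + t ^+ 2 *: (U *m V^T)) - f X -
      k / 2 * t ^+ 2| <= (- k / 4) * t ^+ 2.
    near: t; apply: taylor2_quadratic_curve => //.
    by rewrite divr_gt0 // oppr_gt0.
  have : f X <= f (X + t *: (U *m B^T + A *m V^T) + t ^+ 2 *: (U *m V^T)).
    by near: t; apply: cvg_within; exact: curve_min.
  rewrite ler_norml => fle /andP[_ taylor].
  have : k / 4 * t ^+ 2 < 0 by rewrite nmulr_rlt0 ?exprn_gt0 // pmulr_llt0.
  by lra.
Unshelve. all: by end_near. Qed.

(* In \bar R the inverse satisfies 0^-1 = +oo. *)
Theorem theorem1 (R : realType) (m n r : nat)
    (hm : (0 < m)%N) (hn : (0 < n)%N) (hr : (0 < r)%N)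
    (hrmn : (r <= minn m n)%N)
    (f : 'M[R]_(m, n) -> R) (hf : twice_differentiable f)
    (A : 'M[R]_(m, r)) (B : 'M[R]_(n, r)) :
  (SOSP (factored f) (A, B) ->
     forall eta : R, 0 < eta ->
       (eta%:E <= (beta_local r f (A *m B^T))^-1)%E ->
       pgd_fixed_point r f eta (A *m B^T)) /\
  (~ SOSP (factored f) (A, B) -> ~ local_min_rank r f (A *m B^T)).
Proof.
split=> [hS eta|nS hmin]; first exact: SOSP_pgd_fixed_point.
by apply: nS; exact: local_min_rank_SOSP.
Qed.
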